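(* Let $G$ be a topological group and let $H$ be a t.d.l.c. completion of $G$ via $\phi: G\rightarrow H$. Then the set $\mathcal{S}$ of all preimages under $\phi$ of compact open subgroups of $H$ is a $G$-stable local filter, and moreover, there is a unique topological group isomorphism $\psi: \hat{G}_{\mathcal{S}}\rightarrow H$ such that $\phi=\psi\circ\beta_{(G,\mathcal{S})}$.
   Context: Topological groups are Hausdorff. A t.d.l.c. group is a totally disconnected, locally compact (Hausdorff) topological group. $H$ is a t.d.l.c. completion of $G$ via $\phi:G\rightarrow H$ if $H$ is a t.d.l.c. group and $\phi$ is a continuous homomorphism with dense image. Two subgroups $U,V$ of a group are commensurate if $U\cap V$ has finite index in both. A $G$-stable local filter is a set $\mathcal{S}$ of open subgroups of $G$ such that: (a) $\mathcal{S}$ is non-empty; (b) any two elements of $\mathcal{S}$ are commensurate; (c) finite intersections of elements of $\mathcal{S}$ lie in $\mathcal{S}$, and given $V\le W\le G$ with $|W:V|$ finite, $V\in\mathcal{S}$ implies $W\in\mathcal{S}$; (d) if $V\in\mathcal{S}$ and $g\in G$ then $gVg^{-1}\in\mathcal{S}$. Completion with respect to $\mathcal{S}$. A (right) $\mathcal{S}$-Cauchy filter in $G$ is a filter $f$ of subsets of $G$ such that for every $V\in\mathcal{S}$ there is exactly one right coset $Vg$ of $V$ with $Vg\in f$, and every element of $f$ contains a right coset of some element of $\mathcal{S}$. The set $\hat{G}_{\mathcal{S}}$ consists of all $\mathcal{S}$-Cauchy filters in $G$, with the topology of the uniformity whose entourages are $E_U=\{(f,f')\mid \exists g\in G: Ug\in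 f\cap f'\}$ for $U\in\mathcal{S}$. For $f,f'\in\hat{G}_{\mathcal{S}}$, the product $ff'$ is the $\mathcal{S}$-Cauchy filter generated by the sets $AB$ with $A\in f$, $B\in f'$; with this multiplication $\hat{G}_{\mathcal{S}}$ is a topological group. The map $\beta_{(G,\mathcal{S})}:G\rightarrow\hat{G}_{\mathcal{S}}$ sends $g$ to the filter generated by $\{Vg\mid V\in\mathcal{S}\}$; it is a continuous homomorphism with dense image.
   Formalization: In the definition of an S-Cauchy filter f, the right coset contained in each element of f is required to belong to f; otherwise, for G = Z and S = {p^n Z}, the filter generated by the sets p^n Z \ {0} would be Cauchy and the completion would not be Hausdorff. *)

(* Defs.v *)
From HB Require Import structures.
From mathcomp Require Import all_boot all_classical topology.

Set Implicit Arguments.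
Unset Strict Implicit.
Unset Printing Implicit Defensive.

Local Open Scope classical_set_scope.
Local Open Scope relation_scope.
Local Open Scope group_scope.

HB.mixin Record isTopologicalGroup G of Group G & Topological G := {
  mulg_continuous : continuous (fun xy : G * G => xy.1 * xy.2) ;
  invg_continuous : continuous (fun x : G => x^-1) ;
  topgroup_hausdorff : hausdorff_space G }.

#[short(type="topGroupType")]
HB.structure Definition TopologicalGroup :=
  {G of isTopologicalGroup G & Group G & Topological G}.

Definition tdlc (H : topGroupType) :=
  totally_disconnected [set: H] /\ locally_compact [set: H].

Record tdlc_completion (G H : topGroupType) (phi : G -> H) : Prop := {
  tdlc_completion_tdlc : tdlc H ;
  tdlc_completion_morph : {morph phi : x y / x * y} ;
  tdlc_completion_continuous : continuous phi ;
  tdlc_completion_dense : dense (range phi) }.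

Record topgroup_isom (G H : topGroupType) (psi : G -> H) : Prop := {
  topgroup_isom_morph : {morph psi : x y / x * y} ;
  topgroup_isom_continuous : continuous psi ;
  topgroup_isom_inv :
    exists2 chi : H -> G, cancel psi chi /\ cancel chi psi & continuous chi }.

Section subgroups.
Context {G : groupType}.
Implicit Types (A B U V W : set G) (f h : set_system G) (g : G).

Definition subgroup V := group_closed (mem V).

Definition rcoset V g : set G := [set v * g | v in V].

Definition conjset g V : set G := [set g * v * g^-1 | v in V].

Definition setmul A B : set G := [set a * b | a in A & b in B].

Definition setinv A : set G := [set a^-1 | a in A].

(* Only used for subgroups V `<=` W: the index |W : V| is finite. *)
Definition finite_index W V := finite_set [set rcoset V w | w in W].

Definition commensurate U V :=
  finite_index U (U `&` V) /\ finite_index V (U `&` V).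

Lemma subgroupP V : subgroup V <->
  [/\ V 1, forall x y, V x -> V y -> V (x * y) & forall x, V x -> V x^-1].
Proof.
split=> [[/set_mem V1 Vd]|[V1 VM VV]]; last first.
  split; first exact/mem_set.
  by move=> x y /set_mem Vx /set_mem Vy; apply/mem_set/VM => //; apply: VV.
have VV x : V x -> V x^-1.
  move=> Vx; rewrite -[x^-1]mul1g.
  by apply/set_mem/(Vd 1 x); apply/mem_set.
split=> // x y Vx Vy; rewrite -[y]invgK.
by apply/set_mem/(Vd x y^-1); apply/mem_set => //; apply: VV.
Qed.

Lemma rcosetE V g x : rcoset V g x <-> V (x * g^-1).
Proof.
split=> [[v Vv <-]|Vx]; first by rewrite mulgK.
by exists (x * g^-1) => //; rewrite mulgVK.
Qed.

Lemma rcoset_eq V g x : subgroup V -> rcoset V g x -> rcoset V g = rcoset V x.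
Proof.
move=> /subgroupP[V1 VM VV] /rcosetE Vxg; apply/seteqP; split=> y /rcosetE Vy.
  apply/rcosetE; have -> : y * x^-1 = (y * g^-1) * (x * g^-1)^-1.
    by rewrite invgM invgK mulgA mulgVK.
  by apply: VM => //; apply: VV.
by apply/rcosetE; have := VM _ _ Vy Vxg; rewrite mulgA mulgVK.
Qed.

Lemma rcoset_refl V g : subgroup V -> rcoset V g g.
Proof. by move=> /subgroupP[V1 _ _]; apply/rcosetE; rewrite mulgV. Qed.

Lemma conjsetE V g x : conjset g V x <-> V (g^-1 * x * g).
Proof.
split=> [[v Vv <-]|Vx]; first by rewrite !mulgA mulVg mul1g mulgVK.
by exists (g^-1 * x * g) => //; rewrite !mulgA mulgV mul1g mulgK.
Qed.

Lemma subgroupI U V : subgroup U -> subgroup V -> subgroup (U `&` V).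
Proof.
move=> /subgroupP[U1 UM UV] /subgroupP[V1 VM VV]; apply/subgroupP; split=> //.
- by move=> x y [? ?] [? ?]; split; [apply: UM|apply: VM].
- by move=> x [? ?]; split; [apply: UV|apply: VV].
Qed.

End subgroups.

(* Closure under finite (nonempty) intersections is the binary clause, as for
   filters. *)
Record stable_local_filter (G : topGroupType) (S : set (set G)) : Prop := {
  slf_subgroup : forall V, S V -> subgroup V ;
  slf_open : forall V, S V -> open V ;
  slf_nonempty : S !=set0 ;
  slf_commensurate : forall U V, S U -> S V -> commensurate U V ;
  slf_capI : forall U V, S U -> S V -> S (U `&` V) ;
  slf_finite_index : forall V W, subgroup W -> V `<=` W -> finite_index W V ->
    S V -> S W ;
  slf_conj : forall V g, S V -> S (conjset g V) }.

Record localFilter (G : topGroupType) := LocalFilter {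
  local_filter_set :> set G -> Prop ;
  local_filterP : stable_local_filter local_filter_set }.

(* A filter in the sense of Bourbaki, i.e. a proper one.  In the last clause
   the coset contained in A has to be one that belongs to f: without this, for
   instance on G = Z with S the subgroups p^n Z, the filter generated by the
   sets p^n Z \ {0} would be a Cauchy filter distinct from the one generated by
   the p^n Z but not separated from it by the entourages below. *)
Record cauchy_filter (G : groupType) (S : set (set G)) (f : set_system G)
    : Prop := {
  cauchy_filter_proper : ProperFilter f ;
  cauchy_filter_coset : forall V, S V ->
    exists! C, range (rcoset V) C /\ f C ;
  cauchy_filter_base : forall A, f A ->
    exists V g, [/\ S V, f (rcoset V g) & rcoset V g `<=` A] }.

Definition beta_filter (G : groupType) (S : set (set G)) (g : G)
    : set_system G :=
  filter_from S (fun V => rcoset V g).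

Definition mul_filter (G : groupType) (f h : set_system G) : set_system G :=
  filter_from [set AB | f AB.1 /\ h AB.2] (fun AB => setmul AB.1 AB.2).

Definition inv_filter (G : groupType) (f : set_system G) : set_system G :=
  filter_from f setinv.

Section completion.
Context {G : topGroupType}.

Record completion (S : localFilter G) := Completion {
  completion_filter :> set G -> Prop ;
  completionP : cauchy_filter S completion_filter }.

Variable S : localFilter G.
Implicit Types (f h : completion S) (U V W : set G) (g : G).

HB.instance Definition _ := gen_eqMixin (completion S).
HB.instance Definition _ := gen_choiceMixin (completion S).

Let Ssub V : S V -> subgroup V.
Proof. exact: slf_subgroup (local_filterP S) _. Qed.

Let SI U V : S U -> S V -> S (U `&` V).
Proof. exact: slf_capI (local_filterP S) _ _. Qed.

Let SJ g V : S V -> S (conjset g V).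
Proof. exact: slf_conj (local_filterP S) _ _. Qed.

Let S_ex : exists V, S V.
Proof. by case: (slf_nonempty (local_filterP S)) => V; exists V. Qed.

#[local] Instance completion_proper f : ProperFilter f.
Proof. exact: cauchy_filter_proper (completionP f). Qed.

Lemma completion_coset f V : S V -> exists g, f (rcoset V g).
Proof.
by move=> /(cauchy_filter_coset (completionP f))[_ [[[g _ <-] fg] _]]; exists g.
Qed.

Lemma completion_base f A : f A ->
  exists V g, [/\ S V, f (rcoset V g) & rcoset V g `<=` A].
Proof. exact: cauchy_filter_base (completionP f) _. Qed.

Lemma completion_eq f h :
  (forall V g, S V -> f (rcoset V g) -> h (rcoset V g)) -> f = h.
Proof.
move=> fh; suff: completion_filter f = completion_filter h.
  move: f h {fh} => [f fP] [h hP] /= fh; case: _ / fh hP => hP.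
  by congr Completion; exact: Prop_irrelevance.
apply/seteqP; split=> A.
  by move=> /completion_base[V [g [SV fV /filterS]]]; apply; exact: fh.
move=> /completion_base[V [g [SV hV /filterS]]]; apply.
have [g' fg'] := completion_coset f SV; have hg' := fh _ _ SV fg'.
have [x [Vx Vx']] := filter_ex (filterI hV hg').
by rewrite (rcoset_eq (Ssub SV) Vx) -(rcoset_eq (Ssub SV) Vx').
Qed.

Lemma mk_cauchy (F : set_system G) : ProperFilter F ->
  (forall V, S V -> exists g, F (rcoset V g)) ->
  (forall A, F A -> exists V g, [/\ S V, F (rcoset V g) & rcoset V g `<=` A]) ->
  cauchy_filter S F.
Proof.
move=> FF Fco Fba; split=> // V SV; have [g Fg] := Fco _ SV.
exists (rcoset V g); split; first by split=> //; exists g.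
move=> _ [[g' _ <-] Fg'].
have [x [Vx Vx']] := filter_ex (filterI Fg Fg').
by rewrite (rcoset_eq (Ssub SV) Vx) -(rcoset_eq (Ssub SV) Vx').
Qed.

Lemma beta_cauchy g : cauchy_filter S (beta_filter S g).
Proof.
have betaV V : S V -> beta_filter S g (rcoset V g) by exists V.
apply: mk_cauchy => [|V SV|A [V SV VA]]; last 2 first.
- by exists g; exact: betaV.
- by exists V, g; split => //; exact: betaV.
apply: filter_from_proper => [|V SV]; last first.
  by exists g; apply: rcoset_refl; exact: Ssub.
apply: filter_from_filter => // U V SU SV.
by exists (U `&` V) => [|_ [x [Ux Vx] <-]]; [exact: SI|split; exists x].
Qed.

Definition beta g : completion S := Completion (beta_cauchy g).

Lemma mul_filterP (f h : set_system G) A : mul_filter f h A <->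
  exists B C, [/\ f B, h C & forall b c, B b -> C c -> A (b * c)].
Proof.
split=> [[[B C] /= [fB hC] BCA]|[B [C [fB hC BCA]]]].
  by exists B, C; split=> // b c Bb Cc; apply: BCA; exists b => //; exists c.
by exists (B, C) => //= _ [b Bb [c Cc <-]]; exact: BCA.
Qed.

Lemma mul_coset f h V a b : S V ->
  f (rcoset V a) -> h (rcoset (conjset a^-1 V) b) ->
  mul_filter f h (rcoset V (a * b)).
Proof.
move=> SV fV hV; apply/mul_filterP; exists (rcoset V a).
exists (rcoset (conjset a^-1 V) b); split=> // x y /rcosetE Vx /rcosetE.
move=> /conjsetE; rewrite invgK => Vy; apply/rcosetE.
have /subgroupP[_ VM _] := Ssub SV.
have := VM _ _ Vx Vy; rewrite invgM !mulgA mulgVK.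
by [].
Qed.

Lemma mul_proper f h : ProperFilter (mul_filter f h).
Proof.
apply: filter_from_proper => [|[B C] [/= fB hC]]; last first.
  have [[b Bb] [c Cc]] := (filter_ex fB, filter_ex hC).
  by exists (b * c), b => //; exists c.
apply: filter_from_filter; first by exists (setT, setT); split; exact: filterT.
move=> [B C] [B' C'] [/= fB hC] [/= fB' hC'].
exists (B `&` B', C `&` C') => /=; first by split; exact: filterI.
by move=> _ [b [Bb Bb'] [c [Cc Cc'] <-]]; split; exists b => //; exists c.
Qed.

Lemma mul_cauchy f h : cauchy_filter S (mul_filter f h).
Proof.
have co V a : S V -> f (rcoset V a) -> exists b,
    h (rcoset (conjset a^-1 V) b) /\ mul_filter f h (rcoset V (a * b)).
  move=> SV fa; have [b hb] := completion_coset h (SJ a^-1 SV).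
  by exists b; split=> //; exact: mul_coset.
apply: mk_cauchy => [|V SV|A]; first exact: mul_proper.
  have [a fa] := completion_coset f SV; have [b [_ ?]] := co _ _ SV fa.
  by exists (a * b).
move=> /mul_filterP[B [C [fB hC BCA]]].
have [V [a [SV fa VB]]] := completion_base fB.
have [b [hb fhb]] := co _ _ SV fa.
have [c [Vc Cc]] := filter_ex (filterI hb hC).
exists V, (a * b); split => // x /rcosetE Vx.
rewrite -[x](mulgVK c); apply: BCA => //; apply: VB; apply/rcosetE.
have /subgroupP[_ VM VV] := Ssub SV.
move: Vc => /rcosetE /conjsetE; rewrite invgK => /VV /(VM _ _ Vx).
by rewrite !invgM !invgK !mulgA !mulgVK.
Qed.

Lemma stable_core f V : S V ->
  exists g, f (rcoset (conjset g V) g).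
Proof.
move=> SV; have [g0 f0] := completion_coset f SV.
pose W := conjset g0 V; have SW : S W by exact: SJ.
have SVW := SI SV SW; have /subgroupP[X1 XM XV] := Ssub SVW.
pose D := [set conjset v^-1 (V `&` W) | v in V].
have finD : finite_set D.
  have [+ _] := slf_commensurate (local_filterP S) SV SW.
  move=> /(finite_image (fun C => [set c^-1 * d | c in C & d in C])).
  apply: sub_finite_set => _ [v Vv <-]; exists (rcoset (V `&` W) v).
    by exists v.
  apply/seteqP; split=> x.
    move=> [_ [c Vc <-] [_ [d Vd <-] <-]]; apply/conjsetE.
    rewrite invgK invgM !mulgA mulgV mul1g mulgK.
    by apply: XM => //; exact: XV.
  move=> /conjsetE; rewrite invgK => Vx.
  exists v; first by exists 1 => //; rewrite mul1g.
  exists (v * x); last by rewrite mulKg.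
  by exists (v * x * v^-1) => //; rewrite mulgVK.
have [N SN NW] : exists2 N, S N & forall v, V v -> N `<=` conjset v^-1 (V `&` W).
  have FF : Filter (filter_from S id).
    by apply: filter_from_filter => // P Q SP SQ; exists (P `&` Q) => //; exact: SI.
  move/finite_fsetP: finD => [X DX].
  have [|N SN ND] := @filter_bigI _ _ X id _ FF.
    move=> P PX; have : D P by rewrite DX.
    by move=> [v Vv <-]; exists (conjset v^-1 (V `&` W)) => //; exact: SJ.
  exists N => // v Vv x /ND; apply.
  by rewrite -DX; exists v.
have [n fn] := completion_coset f SN.
have [g [/rcosetE Vg Ng]] := filter_ex (filterI f0 fn).
exists g; move: fn; rewrite (rcoset_eq (Ssub SN) Ng); apply: filterS.
have /subgroupP[_ _ VV] := Ssub SV.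
move=> x /rcosetE /(NW _ (VV _ Vg)) /conjsetE [_ /conjsetE]; rewrite invgK => Vx.
apply/rcosetE/conjsetE; move: Vx.
by rewrite !invgM !invgK !mulgA mulVg mul1g !mulgVK.
Qed.

Lemma inv_filterP (f : set_system G) A : Filter f ->
  inv_filter f A <-> f [set x | A x^-1].
Proof.
move=> ff; split=> [[B fB BA]|fA]; last first.
  by exists [set x | A x^-1] => // _ [x /= Ax <-].
by apply: filterS fB => x Bx; apply: BA; exists x.
Qed.

Lemma inv_coset f V g :
  f (rcoset (conjset g V) g) -> S V -> inv_filter f (rcoset V g^-1).
Proof.
move=> fV SV; apply/inv_filterP; apply: filterS fV => x.
have /subgroupP[_ _ VV] := Ssub SV.
move=> /rcosetE /conjsetE /VV Vx; apply/rcosetE.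
by rewrite invgK; move: Vx; rewrite mulgA mulgVK invgM invgK.
Qed.

Lemma inv_cauchy f : cauchy_filter S (inv_filter f).
Proof.
apply: mk_cauchy => [|V SV|A].
- apply: filter_from_proper => [|B fB]; last first.
    by have [b Bb] := filter_ex fB; exists b^-1, b.
  apply: filter_from_filter; first by exists setT; exact: filterT.
  move=> B C fB fC; exists (B `&` C); first exact: filterI.
  by move=> _ [x [Bx Cx] <-]; split; exists x.
- by have [g fg] := stable_core f SV; exists g^-1; exact: inv_coset.
- move=> [B fB BA]; have [V [g [SV fV VB]]] := completion_base fB.
  have SW : S (conjset g^-1 V) by exact: SJ.
  have [k fk] := stable_core f SW.
  exists (conjset g^-1 V), k^-1; split=> //; first exact: inv_coset.
  have [c [/rcosetE Vc /rcosetE Wc]] := filter_ex (filterI fV fk).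
  have /subgroupP[_ VM VV] := Ssub SV.
  move=> x /rcosetE; rewrite invgK => /conjsetE; rewrite invgK => Wx.
  apply: BA; exists x^-1; last by rewrite invgK.
  apply: VB; apply/rcosetE; move: Wc => /conjsetE/conjsetE.
  rewrite invgK => Wc.
  have := VM _ _ Vc (VV _ (VM _ _ Wx Wc)).
  by rewrite !invgM !invgK !mulgA !(mulgVK, mulgK) mulgV mul1g.
Qed.

Definition completion_mul f h : completion S := Completion (mul_cauchy f h).
Definition completion_inv f : completion S := Completion (inv_cauchy f).

Lemma completion_mulA : associative completion_mul.
Proof.
move=> f h k; apply: completion_eq => V g SV.
move=> /mul_filterP[B [C [fB /mul_filterP[D [E [hD kE CDE]]] ABC]]].
apply/mul_filterP; exists (setmul B D), E; split=> //.
  by apply/mul_filterP; exists B, D; split=> // b d Bb Dd; exists b => //; exists d.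
move=> _ e [b Bb [d Dd <-]] Ee; rewrite -mulgA; apply: ABC => //; exact: CDE.
Qed.

Lemma completion_mul1 : left_id (beta 1) completion_mul.
Proof.
move=> f; apply/esym/completion_eq => V g SV fV; apply/mul_filterP.
exists V, (rcoset V g); split=> //.
  by exists V => // _ [v Vv <-]; rewrite mulg1.
have /subgroupP[_ VM _] := Ssub SV.
by move=> v _ Vv [w Vw <-]; exists (v * w); [exact: VM|rewrite mulgA].
Qed.

Lemma completion_mulr1 : right_id (beta 1) completion_mul.
Proof.
move=> f; apply/esym/completion_eq => V g SV fV.
rewrite -[g]mulg1; apply: mul_coset => //.
by exists (conjset g^-1 V) => //; exact: SJ.
Qed.

Lemma completion_mulV : left_inverse (beta 1) completion_inv completion_mul.
Proof.
move=> f; apply/esym/completion_eq => V g SV [U SU /(_ _ (rcoset_refl _ (Ssub SU))) Vg].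
have [k fk] := stable_core f SV.
rewrite (rcoset_eq (Ssub SV) Vg); apply/mul_filterP.
exists (rcoset V k^-1), (rcoset (conjset k V) k); split=> //.
  exact: inv_coset.
have /subgroupP[_ VM _] := Ssub SV.
move=> x y /rcosetE; rewrite invgK => Vx /rcosetE/conjsetE; rewrite mulgA mulgVK => Vy.
apply/rcosetE; rewrite invg1 mulg1.
by have := VM _ _ Vx Vy; rewrite !mulgA mulgK.
Qed.

Lemma completion_mulgV : right_inverse (beta 1) completion_inv completion_mul.
Proof.
move=> f; apply/esym/completion_eq => V g SV [U SU /(_ _ (rcoset_refl _ (Ssub SU))) Vg].
have [k fk] := completion_coset f SV.
rewrite (rcoset_eq (Ssub SV) Vg); apply/mul_filterP.
exists (rcoset V k), (setinv (rcoset V k)); split=> //.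
  by exists (rcoset V k).
have /subgroupP[_ VM VV] := Ssub SV.
move=> x _ /rcosetE Vx [y /rcosetE Vy <-].
apply/rcosetE; rewrite invg1 mulg1.
by have := VM _ _ Vx (VV _ Vy); rewrite invgM invgK mulgA mulgVK.
Qed.

HB.instance Definition _ := isGroup.Build (completion S)
  completion_mulA completion_mul1 completion_mulr1
  completion_mulV completion_mulgV.

Definition completion_entourage : set_system (completion S * completion S) :=
  filter_from S (fun U => [set ff' : completion S * completion S |
    exists g, ff'.1 (rcoset U g) /\ ff'.2 (rcoset U g)]).

Lemma completion_coset_eq f V a b : S V ->
  f (rcoset V a) -> f (rcoset V b) -> rcoset V a = rcoset V b.
Proof.
move=> SV fa fb; have [x [Vx Vx']] := filter_ex (filterI fa fb).
by rewrite (rcoset_eq (Ssub SV) Vx) -(rcoset_eq (Ssub SV) Vx').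
Qed.

Lemma completion_entourage_filter : Filter completion_entourage.
Proof.
apply: filter_from_filter => // U V SU SV.
exists (U `&` V) => [|[f h] /= [g [fg hg]]]; first exact: SI.
by split; exists g; split;
  [apply: filterS fg|apply: filterS hg|apply: filterS fg|apply: filterS hg];
  move=> _ [x [Ux Vx] <-]; exists x.
Qed.

Lemma completion_entourage_diagonal A :
  completion_entourage A -> diagonal `<=` A.
Proof.
move=> [U SU UA] [f h] /diagonalP <-; apply: UA.
by have [g fg] := completion_coset f SU; exists g.
Qed.

Lemma completion_entourage_inv A :
  completion_entourage A -> completion_entourage A^-1%relation.
Proof.
move=> [U SU UA]; exists U => // -[f h] /= [g [fg hg]].
by apply: UA; exists g.
Qed.

Lemma completion_entourage_split A : completion_entourage A ->
  exists2 B, completion_entourage B & (B \; B `<=` A)%relation.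
Proof.
move=> [U SU UA].
exists [set ff' : completion S * completion S |
    exists g, ff'.1 (rcoset U g) /\ ff'.2 (rcoset U g)]; first by exists U.
move=> [f h] [k /= [a [fa ka]] [b [kb hb]]]; apply: UA; exists a; split => //=.
by rewrite (completion_coset_eq SU ka kb).
Qed.

HB.instance Definition _ := isUniform.Build (completion S)
  completion_entourage_filter completion_entourage_diagonal
  completion_entourage_inv completion_entourage_split.

Lemma completion_nbhsP f (A : set (completion S)) : nbhs f A <->
  exists U g, [/\ S U, f (rcoset U g) & forall h, h (rcoset U g) -> A h].
Proof.
split.
  rewrite nbhsP => -[B [U SU UB] BA].
  have [g fg] := completion_coset f SU; exists U, g; split=> // h hg.
  by apply: BA; apply/mem_set/UB; exists g.
move=> [U [g [SU fg UA]]]; apply/nbhsP.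
exists [set ff' : completion S * completion S |
    exists g, ff'.1 (rcoset U g) /\ ff'.2 (rcoset U g)]; first by exists U.
move=> h /set_mem /= [k [fk hk]]; apply: UA.
by rewrite (completion_coset_eq SU fg fk).
Qed.

Lemma completion_mul_continuous :
  continuous (fun ff' : completion S * completion S => ff'.1 * ff'.2).
Proof.
move=> [f h] A /= /completion_nbhsP[U [g [SU fhg UA]]].
have [a fa] := completion_coset f SU.
have SU' := SJ a^-1 SU; have [b hb] := completion_coset h SU'.
have Uab := completion_coset_eq SU fhg (mul_coset SU fa hb).
exists ([set k : completion S | k (rcoset U a)],
  [set k : completion S | k (rcoset (conjset a^-1 U) b)]).
  by split; apply/completion_nbhsP; [exists U, a|exists (conjset a^-1 U), b].
by move=> [f' h'] [/= fa' hb']; apply: UA; rewrite Uab; exact: mul_coset.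
Qed.

Lemma completion_inv_continuous : continuous (fun f : completion S => f^-1).
Proof.
move=> f A /= /completion_nbhsP[U [g [SU fg UA]]].
have [k fk] := stable_core f SU.
have Uk := completion_coset_eq SU fg (inv_coset fk SU).
apply/completion_nbhsP; exists (conjset k U), k; split=> //; first exact: SJ.
by move=> h hk; apply: UA; rewrite Uk; exact: inv_coset.
Qed.

Lemma completion_hausdorff : hausdorff_space (completion S).
Proof.
move=> f h fh; apply: completion_eq => V g SV fg.
have [k hk] := completion_coset h SV.
have [||l /= [lg lk]] := fh [set l : completion S | l (rcoset V g)]
  [set l : completion S | l (rcoset V k)].
- by apply/completion_nbhsP; exists V, g.
- by apply/completion_nbhsP; exists V, k.
by rewrite (completion_coset_eq SV lg lk).
Qed.

HB.instance Definition _ := isTopologicalGroup.Build (completion S)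
  completion_mul_continuous completion_inv_continuous completion_hausdorff.

Lemma beta_morph : {morph beta : x y / x * y}.
Proof.
move=> x y; apply: completion_eq => V g SV.
move=> [U SU /(_ _ (rcoset_refl _ (Ssub SU))) Vxy].
rewrite (rcoset_eq (Ssub SV) Vxy); apply: mul_coset => //; first by exists V.
by exists (conjset x^-1 V) => //; exact: SJ.
Qed.

Lemma beta_continuous : continuous beta.
Proof.
move=> x A /= /completion_nbhsP[U [g [SU [V SV VU] UA]]].
have Ux : rcoset U g x by apply/VU/rcoset_refl/Ssub.
have /subgroupP[U1 _ _] := Ssub SU.
have : nbhs (x * x^-1) U.
  rewrite mulgV; apply: open_nbhs_nbhs; split=> //.
  exact: slf_open (local_filterP S) _ SU.
move=> /(mulg_continuous (x, x^-1))[[P Q] [/= Px Qx] PQU].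
apply: filterS Px => y Py; apply: UA.
have Uy : U (y * x^-1) by apply: (PQU (y, x^-1)); split=> //; exact: nbhs_singleton.
exists U => //; rewrite (rcoset_eq (Ssub SU) Ux).
by rewrite (@rcoset_eq _ U x y (Ssub SU)) //; exact/rcosetE.
Qed.

Lemma beta_dense : dense (range beta).
Proof.
move=> O [f Of] Oo; have : nbhs f O by exact: open_nbhs_nbhs.
move=> /completion_nbhsP[U [g [SU _ UO]]].
by exists (beta g); split; [apply: UO; exists U|exists g].
Qed.

End completion.

Definition compact_open_preimages (G H : topGroupType) (phi : G -> H)
    : set (set G) :=
  [set phi @^-1` K | K in [set K | [/\ subgroup K, compact K & open K]]].

(* Main.v *)
Require Import Defs.
From HB Require Import structures.
From mathcomp Require Import all_boot all_classical topology.

(** Everything rests on van Dantzig's theorem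
    ([compact_open_subgroup_basis]): in a t.d.l.c. group H the compact open
    subgroups K form a base of neighbourhoods of 1.  In a compact Hausdorff
    space the intersection of all clopen sets around a point is connected
    ([quasi_component_connected]); in a totally disconnected space it is
    therefore a point, and compactness turns this into arbitrarily small
    compact open sets C around 1
    ([totally_disconnected_compact_open]).  The right stabilizer of such a C
    is then an open subgroup contained in C.

    Since phi has dense image, every coset K h contains some phi g, so that
    the preimage of K h is the coset (phi^-1 K) g of the preimage of K.  That
    the preimages are commensurate comes from compactness.  The delicate axiom
    of a local filter is the closure under overgroups W of finite index: there
    W is the preimage of K phi(W), which density makes a subgroup
    ([finite_index_overgroup]).

    For the isomorphism it is easier to describe the inverse.  A point h of H
    leaves on G the trace filter generated by the sets phi^-1 (K h), which is
    Cauchy, and which contains (phi^-1 K) g exactly when h lies in K phi(g)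
    ([traceP]).  This equivalence identifies the basic open sets on both
    sides, whence continuity both ways; injectivity is the Hausdorff property
    together with van Dantzig's theorem, and surjectivity holds since the image
    of a Cauchy filter contains a compact coset and so has a cluster point,
    whose trace is the filter.  Uniqueness is the density of the image of
    [beta]. *)

Set Implicit Arguments.
Unset Strict Implicit.
Unset Printing Implicit Defensive.

Local Open Scope classical_set_scope.
Local Open Scope group_scope.

(** * Quasi-components and small compact open sets *)

Section compactness.
Context {T : topologicalType}.
Implicit Types (K N C U V : set T).

(** The finite intersection property, for families of closed sets that are
    given as the closures of the members of a filter. *)
Lemma compact_meets_cluster K (F : set_system T) : Filter F -> compact K ->
  (forall W, F W -> K `&` closure W !=set0) -> K `&` cluster F !=set0.
Proof.
move=> FF cK KF; pose G := filter_from F (fun W => K `&` closure W).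
have FG : ProperFilter G.
  apply: filter_from_proper => //; apply: filter_from_filter.
    by exists setT; exact: filterT.
  move=> A B FA FB; exists (A `&` B); first exact: filterI.
  by move=> x [Kx /closureI[? ?]].
have [|x [Kx Gx]] := cK G FG.
  by exists setT; [exact: filterT|move=> x []].
exists x; split=> //; rewrite clusterE => W FW.
apply: closed_closure; move: Gx; rewrite clusterE; apply.
by exists W => // y [].
Qed.

(** If the closures of all neighbourhoods of L met K, some x in K would lie in
    all of them; then the closures of all neighbourhoods of x would meet L, and
    some y in L would not be separated from x, hence be equal to x. *)
Lemma compact_separation K L : hausdorff_space T -> compact K -> compact L ->
  K `&` L = set0 ->
  exists U V, [/\ open U, open V, K `<=` U, L `<=` V & U `&` V = set0].
Proof.
move=> hT cK cL KL0; apply: contrapT => nsep.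
have [|x [Kx Lx]] := @compact_meets_cluster K (set_nbhs L) _ cK.
  move=> W /set_nbhsP[V [oV LV VW]]; apply/set0P/eqP => KW0; apply: nsep.
  exists (~` closure V), V; split => //.
  - exact/closed_openC/closed_closure.
  - move=> y Ky Vy; suff: (K `&` closure W) y by rewrite KW0.
    by split=> //; exact: closureS VW _ Vy.
  - by apply/seteqP; split=> // y [nVy Vy]; exact/nVy/subset_closure.
have [|y [Ly xy]] := @compact_meets_cluster L (nbhs x) _ cL.
  move=> W xW; apply/set0P/eqP => LW0.
  have nL : set_nbhs L (~` closure W).
    move=> y Ly; apply: open_nbhs_nbhs; split.
      exact/closed_openC/closed_closure.
    by move=> Wy; suff: (L `&` closure W) y by rewrite LW0.
  have [y [nWy Wy]] := Lx _ _ nL xW.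
  exact/nWy/subset_closure.
suff: (K `&` L) x by rewrite KL0.
by split=> //; rewrite (hT x y xy).
Qed.

(** For closed N these are the clopen subsets of the subspace N, described
    inside the ambient space. *)
Definition clopen_in N C := [/\ C `<=` N, closed C & closed (N `\` C)].

Definition quasi_component N x :=
  \bigcap_(C in [set C | clopen_in N C /\ C x]) C.

(** The clopen subsets of N around x form a filter base of closed sets, so that
    a compact set missing their intersection already misses one of them. *)
Lemma quasi_component_cover N x K : closed N -> N x -> compact K ->
  quasi_component N x `&` K = set0 ->
  exists C, [/\ clopen_in N C, C x & C `&` K = set0].
Proof.
move=> clN Nx cK QK0; apply: contrapT => nC.
pose F := filter_from [set C | clopen_in N C /\ C x] id.
have FF : Filter F.
  apply: filter_from_filter.
    by exists N; split=> //; split=> //; rewrite setDv; exact: closed0.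
  move=> A B [[AN cA cNA] Ax] [[BN cB cNB] Bx]; exists (A `&` B) => //.
  split=> //; split; first by move=> y [/AN].
    exact: closedI.
  by rewrite setDIr; exact: closedU.
have [|y [Ky Fy]] := @compact_meets_cluster K F FF cK.
  move=> W [C [CN Cx] CW]; apply/set0P/eqP => KW0; apply: nC.
  exists C; split=> //; apply/seteqP; split=> // y [Cy Ky].
  by rewrite -KW0; split=> //; exact/subset_closure/CW.
suff: (quasi_component N x `&` K) y by rewrite QK0.
split=> // C CNx; have [[_ cC _] _] := CNx; apply: cC.
by move: Fy; rewrite clusterE; apply; exists C.
Qed.

(** Suppose that the quasi-component Q of x is split by closed sets E1 and E2,
    with x in E1.  Separate the two pieces by open sets U1 and U2; some clopen
    C around x lies in the union of U1 and U2, and removing U2 from C leaves a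
    smaller clopen set around x.  It contains Q, so that E2 misses Q. *)
Lemma quasi_component_connected N x : hausdorff_space T -> compact N -> N x ->
  connected (quasi_component N x).
Proof.
move=> hT cN Nx; have clN := compact_closed hT cN.
set Q := quasi_component N x.
have Qx : Q x by move=> C [].
have QN : Q `<=` N.
  move=> y; apply; split=> //; split=> //; rewrite setDv; exact: closed0.
have clQ : closed Q by apply: closed_bigI => C [[]].
have key E1 E2 : closed E1 -> closed E2 -> Q `<=` E1 `|` E2 ->
    Q `&` E1 `&` E2 = set0 -> E1 x -> Q `&` E2 = set0.
  move=> cE1 cE2 QE QE0 E1x.
  have cQE E : closed E -> compact (Q `&` E).
    move=> cE; apply: subclosed_compact cN _; first exact: closedI.
    by move=> y [/QN].
  have [|U1 [U2 [oU1 oU2 QU1 QU2 U120]]] :=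
      compact_separation hT (cQE _ cE1) (cQE _ cE2).
    by rewrite setIACA setIid setIA.
  have [||C [[CN cC cNC] Cx CU]] :=
      @quasi_component_cover N x (N `&` ~` (U1 `|` U2)) clN Nx.
  - by apply: compact_closedI => //; apply: open_closedC; exact: openU.
  - apply/seteqP; split=> // y [Qy [_]]; apply.
    by have [?|?] := QE _ Qy; [left; exact: QU1|right; exact: QU2].
  have CU12 y : C y -> ~ U2 y -> U1 y.
    move=> Cy nU2; apply: contrapT => nU1.
    suff: (C `&` (N `&` ~` (U1 `|` U2))) y by rewrite CU.
    by split=> //; split; [exact: CN|case].
  have nU12 y : U1 y -> ~ U2 y.
    by move=> U1y U2y; suff: (U1 `&` U2) y by rewrite U120.
  have QD : Q `<=` C `\` U2.
    move=> y; apply; split; last by split=> //; apply: nU12; exact: QU1.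
    split; first by move=> z [/CN].
      by rewrite setDE; apply: closedI => //; exact: open_closedC.
    have -> : N `\` (C `\` U2) = (N `\` C) `|` (C `&` ~` U1).
      apply/seteqP; split=> z.
        move=> [Nz nz]; have [Cz|?] := pselect (C z); last by left.
        by right; split=> // U1z; apply: nz; split=> //; exact: nU12.
      move=> [[Nz nCz]|[Cz nU1]]; first by split=> // -[].
      by split; [exact: CN|move=> [_ /(CU12 _ Cz)]].
    by apply: closedU => //; apply: closedI => //; exact: open_closedC.
  apply/seteqP; split=> // y [Qy E2y].
  by have [_] := QD _ Qy; apply; exact: QU2.
move=> B [b Bb] [O oO BO] [E cE BE].
have cOc : closed (~` O) by exact: open_closedC.
have EO y : Q y -> E y <-> O y.
  move=> Qy; split=> yy.
    by have : B y by [rewrite BE]; rewrite BO => -[].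
  by have : B y by [rewrite BO]; rewrite BE => -[].
have QEO : Q `<=` E `|` ~` O.
  by move=> y /EO EOy; have [/EOy|] := pselect (O y); [left|right].
have QEO0 : Q `&` E `&` ~` O = set0.
  by apply/seteqP; split=> // y [[/EO EOy /EOy Oy]]; apply.
have [Ex|nEx] := pselect (E x).
  have Q0 := key _ _ cE cOc QEO QEO0 Ex.
  rewrite BO; apply/seteqP; split=> [y []//|y Qy]; split=> //.
  by apply: contrapT => nOy; suff: (Q `&` ~` O) y by rewrite Q0.
have Q0 : Q `&` E = set0.
  apply: key cOc cE _ _ _; first by rewrite setUC.
    by rewrite setIAC.
  by move=> /(EO _ Qx).
by move: Bb; rewrite BE Q0.
Qed.

(** A set that is clopen in N becomes open in the whole space as soon as it is
    contained in the interior of N. *)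
Lemma totally_disconnected_compact_open N x O : hausdorff_space T ->
  totally_disconnected [set: T] -> compact N -> nbhs x N -> nbhs x O ->
  exists C, [/\ compact C, open C, C x & C `<=` O].
Proof.
move=> hT tT cN xN xO; have Nx := nbhs_singleton xN.
have clN := compact_closed hT cN.
have oP : open (N° `&` O°) by apply: openI; exact: open_interior.
have [||C [[CN cC cNC] Cx CP]] :=
    @quasi_component_cover N x (N `&` ~` (N° `&` O°)) clN Nx.
- by apply: compact_closedI => //; exact: open_closedC.
- apply/seteqP; split=> // y [Qy [_ nPy]]; apply: nPy.
  have : connected_component [set: T] x y.
    apply: (connected_component_max _ _ (quasi_component_connected hT cN Nx)).
    - by move=> D [].
    - by [].
    - exact: Qy.
  by rewrite tT // => ->; split.
have {}CP : C `<=` N° `&` O°.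
  move=> y Cy; apply: contrapT => nPy.
  suff: (C `&` (N `&` ~` (N° `&` O°))) y by rewrite CP.
  by split=> //; split=> //; exact: CN.
exists C; split=> //.
- exact: subclosed_compact cC cN CN.
- have -> : C = N° `&` O° `&` ~` (N `\` C).
    apply/seteqP; split=> y; first by move=> Cy; split; [exact: CP|case].
    move=> [[/interior_subset Ny _] nNC]; apply: contrapT => nCy.
    exact: nNC.
  by apply: openI => //; exact: closed_openC.
- by move=> y /CP[_ /interior_subset].
Qed.

End compactness.

(** * Compact open subgroups *)

Section topological_groups.
Context {H : topGroupType}.
Implicit Types (K L X C : set H) (x y a h : H).

Lemma mulgr_continuous a : continuous (fun x => x * a).
Proof.
move=> x A /= /(mulg_continuous (x, a))[[P Q] [/= Px Qa] PQA].
apply: filterS Px => y Py; apply: (PQA (y, a)).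
by split=> //; exact: nbhs_singleton.
Qed.

Lemma mulgl_continuous a : continuous (fun x => a * x).
Proof.
move=> x A /= /(mulg_continuous (a, x))[[P Q] [/= Pa Qx] PQA].
apply: filterS Qx => y Qy; apply: (PQA (a, y)).
by split=> //; exact: nbhs_singleton.
Qed.

Lemma conjg_continuous a : continuous (fun x => a * x * a^-1).
Proof.
move=> x; apply: (@continuous_comp _ _ _ (fun x => a * x) (fun x => x * a^-1)).
  exact: mulgl_continuous.
exact: mulgr_continuous.
Qed.

Lemma open_rcoset K h : open K -> open (rcoset K h).
Proof.
move=> oK; have -> : rcoset K h = (fun x => x * h^-1) @^-1` K.
  by apply/seteqP; split=> x /rcosetE.
by apply: open_comp => // x _; exact: mulgr_continuous.
Qed.

Lemma compact_rcoset K h : compact K -> compact (rcoset K h).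
Proof.
move=> cK; apply: continuous_compact => //.
by apply: continuous_subspaceT; exact: mulgr_continuous.
Qed.

Lemma open_conjset a K : open K -> open (conjset a K).
Proof.
move=> oK; have -> : conjset a K = (fun x => a^-1 * x * a^-1^-1) @^-1` K.
  by apply/seteqP; split=> x; rewrite /= invgK => /conjsetE.
by apply: open_comp => // x _; exact: conjg_continuous.
Qed.

Lemma compact_conjset a K : compact K -> compact (conjset a K).
Proof.
move=> cK; apply: continuous_compact => //.
by apply: continuous_subspaceT; exact: conjg_continuous.
Qed.

Lemma subgroup_conjset a K : subgroup K -> subgroup (conjset a K).
Proof.
move=> /subgroupP[K1 KM KV]; apply/subgroupP; split.
- by apply/conjsetE; rewrite mulg1 mulVg.
- move=> x y /conjsetE Kx /conjsetE Ky; apply/conjsetE.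
  by have := KM _ _ Kx Ky; rewrite !mulgA mulgK.
- by move=> x /conjsetE /KV; rewrite !invgM invgK mulgA => ?; apply/conjsetE.
Qed.

Lemma open_subgroup K : subgroup K -> nbhs 1 K -> open K.
Proof.
move=> /subgroupP[K1 KM KV] nK; rewrite openE => x Kx.
have nKx : nbhs x [set y | K (y * x^-1)].
  by apply: mulgr_continuous; rewrite mulgV.
by apply: filterS nKx => y /= /KM /(_ Kx); rewrite mulgVK.
Qed.

(** If x is adherent to K, then the neighbourhood K x of x meets K. *)
Lemma open_subgroup_closed K : subgroup K -> open K -> closed K.
Proof.
move=> sK oK x Kx; have /subgroupP[K1 KM KV] := sK.
have [|y [Ky /rcosetE Kyx]] := Kx (rcoset K x).
  by apply: open_nbhs_nbhs; split; [exact: open_rcoset|exact: rcoset_refl].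
by have := KM _ _ (KV _ Kyx) Ky; rewrite invgM invgK mulgVK.
Qed.

(** Asking for C g^-1 as well as C g to be contained in C makes this the group
    of all g such that C g = C. *)
Definition stabilizer C : set H :=
  [set g | forall c, C c -> C (c * g) /\ C (c * g^-1)].

Lemma subgroup_stabilizer C : subgroup (stabilizer C).
Proof.
apply/subgroupP; split=> [c Cc|x y Cx Cy c Cc|x Cx c Cc].
- by rewrite invg1 mulg1.
- rewrite invgM !mulgA; split.
    by have [/Cy[]] := Cx _ Cc.
  by have [_ /Cx[]] := Cy _ Cc.
- by rewrite invgK; have [] := Cx _ Cc.
Qed.

(** The tube lemma: C is compact and contained in the open set C, so that one
    neighbourhood of 1 serves all points of C. *)
Lemma nbhs_stabilizer C : compact C -> open C -> nbhs 1 (stabilizer C).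
Proof.
move=> /compact_near_coveringP cC oC.
have near1 : \forall g \near (1 : H), C `<=` (fun c => C (c * g)).
  apply: cC => c Cc.
  have : nbhs (c * 1) C by rewrite mulg1; exact: open_nbhs_nbhs.
  exact: (mulg_continuous (c, 1)).
have near1V : \forall g \near (1 : H), C `<=` (fun c => C (c * g^-1)).
  apply: (@invg_continuous H 1 [set g | C `<=` (fun c => C (c * g))]).
  by rewrite invg1.
by apply: filterS2 near1 near1V => g Cg CVg c Cc; split; [exact: Cg|exact: CVg].
Qed.

Definition compact_open_subgroup : set (set H) :=
  [set K | [/\ subgroup K, compact K & open K]].

(** Van Dantzig's theorem.  As C contains 1, its stabilizer lies in C. *)
Lemma compact_open_subgroup_basis O : tdlc H -> nbhs 1 O ->
  exists2 K, compact_open_subgroup K & K `<=` O.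
Proof.
move=> [tH lH] nO; have hT := @topgroup_hausdorff H.
have [N nN [cN _]] : compact_near (nbhs (1 : H)).
  have [N + NN] := lH 1 I; rewrite withinET; by exists N => //; split.
have [C [cC oC C1 CO]] := totally_disconnected_compact_open hT tH cN nN nO.
have sK := subgroup_stabilizer C.
have oK : open (stabilizer C).
  by apply: open_subgroup => //; exact: nbhs_stabilizer.
have KC : stabilizer C `<=` C by move=> g /(_ 1 C1)[]; rewrite mul1g.
exists (stabilizer C); last exact: subset_trans KC CO.
split=> //; apply: subclosed_compact cC KC; exact: open_subgroup_closed.
Qed.

Lemma compact_open_subgroupI K L : compact_open_subgroup K ->
  compact_open_subgroup L -> compact_open_subgroup (K `&` L).
Proof.
move=> [sK cK oK] [sL cL oL]; split; [exact: subgroupI| |exact: openI].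
by apply: compact_closedI => //; exact: open_subgroup_closed.
Qed.

(** Compactness is applied to the filter of the finite sets of cosets, directed
    by inclusion: each coset of X is an open set on which the map sending x to
    X x is constant, so that one finite set of cosets serves all of K. *)
Lemma compact_finite_index K X : compact K -> subgroup X -> open X ->
  finite_index K X.
Proof.
move=> /compact_near_coveringP cK sX oX.
pose F := filter_from finite_set
  (fun D : set (set H) => [set D' | D `<=` D' /\ finite_set D']).
have FF : Filter F.
  apply: filter_from_filter; first by exists set0.
  move=> A B fA fB; exists (A `|` B); first by rewrite finite_setU.
  by move=> D [ABD fD]; split; split=> //; apply: subset_trans ABD => ? ?;
    [left|right].
have [|D fD KD] := cK _ F (fun D x => finite_set D /\ D (rcoset X x)) FF.
  move=> x Kx; exists (rcoset X x, [set D | D (rcoset X x) /\ finite_set D]).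
    split=> /=.
      by apply: open_nbhs_nbhs; split; [exact: open_rcoset|exact: rcoset_refl].
    by exists [set rcoset X x] => // D [XD fD]; split=> //; exact: XD.
  by move=> [y D] /= [Xy [DX fD]]; split=> //; rewrite -(rcoset_eq sX Xy).
apply: (sub_finite_set _ fD) => _ [x Kx <-].
by have [_] := KD D (conj (@subset_refl _ D) fD) x Kx.
Qed.

Lemma compact_bigcup_finite (E : set (set H)) : finite_set E ->
  (forall C, E C -> compact C) -> compact (\bigcup_(C in E) C).
Proof.
move=> /finite_fsetP[X ->] cE; rewrite bigcup_fset.
rewrite big_seq; apply: bigsetU_compact => C; exact: cE.
Qed.

End topological_groups.

(** * Preimages of compact open subgroups *)

Section preimages.
Context {G H : topGroupType} {phi : G -> H}.
Hypothesis phiM : {morph phi : x y / x * y}.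

Lemma morph1 : phi 1 = 1.
Proof. by apply: (@mulgI _ (phi 1)); rewrite -phiM !mulg1. Qed.

Lemma morphV x : phi x^-1 = (phi x)^-1.
Proof. by apply: (@mulgI _ (phi x)); rewrite -phiM !mulgV morph1. Qed.

Lemma preimage_subgroup K : subgroup K -> subgroup (phi @^-1` K).
Proof.
move=> /subgroupP[K1 KM KV]; apply/subgroupP; split.
- by rewrite /= morph1.
- by move=> x y Kx Ky; rewrite /= phiM; exact: KM.
- by move=> x Kx; rewrite /= morphV; exact: KV.
Qed.

Lemma preimage_rcoset K g : phi @^-1` rcoset K (phi g) = rcoset (phi @^-1` K) g.
Proof.
by apply/seteqP; split=> x /rcosetE Kx; apply/rcosetE; move: Kx;
  rewrite /= phiM morphV.
Qed.

Lemma preimage_conjset K g :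
  phi @^-1` conjset (phi g) K = conjset g (phi @^-1` K).
Proof.
by apply/seteqP; split=> x /conjsetE Kx; apply/conjsetE; move: Kx;
  rewrite /= !phiM morphV.
Qed.

Lemma preimage_finite_index K X : finite_index K X ->
  finite_index (phi @^-1` K) (phi @^-1` X).
Proof.
move=> /(finite_image (fun C => phi @^-1` C)); apply: sub_finite_set.
move=> _ [w Kw <-]; exists (rcoset X (phi w)); first by exists (phi w).
exact: preimage_rcoset.
Qed.

Hypothesis phi_cont : continuous phi.
Hypothesis phi_dense : dense (range phi).

Lemma rcoset_meets_range K h : subgroup K -> open K ->
  exists g, rcoset K h (phi g).
Proof.
move=> sK oK; have [|y [Ky [g _ gy]]] := phi_dense _ (open_rcoset h oK).
  by exists h; exact: rcoset_refl.
by exists g; rewrite gy.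
Qed.

(** W is the preimage of L = K phi(W).  This L is a union of finitely many
    cosets of K, hence compact and open; it is a subgroup provided that phi(w) K
    is contained in K phi(W) for every w in W, and this holds by density of the
    image of phi. *)
Lemma finite_index_overgroup K W : compact_open_subgroup K -> subgroup W ->
    phi @^-1` K `<=` W -> finite_index W (phi @^-1` K) ->
  exists2 L, compact_open_subgroup L & phi @^-1` L = W.
Proof.
move=> [sK cK oK] sW KW fW; have /subgroupP[K1 KM KV] := sK.
have /subgroupP[W1 WM WV] := sW.
pose E := [set rcoset K (phi w) | w in W].
have inE x w : W w -> K (x * (phi w)^-1) -> (\bigcup_(C in E) C) x.
  by move=> Ww Kxw; exists (rcoset K (phi w)); [exists w|exact/rcosetE].
have Ein x : (\bigcup_(C in E) C) x -> exists2 w, W w & K (x * (phi w)^-1).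
  by move=> [_ [w Ww <-] /rcosetE]; exists w.
(* Choose phi g in K k that is also in phi(w)^-1 K phi(w) k: then phi(w) k is
   in K phi(w g), and g is in W since phi g is in K. *)
have swap w k : W w -> K k -> exists2 v, W v & K (phi w * k * (phi v)^-1).
  move=> Ww Kk.
  have sKw : subgroup (K `&` conjset (phi w)^-1 K).
    by apply: subgroupI => //; exact: subgroup_conjset.
  have [|g /rcosetE[Kgk /conjsetE]] := rcoset_meets_range k sKw.
    by apply: openI => //; exact: open_conjset.
  rewrite invgK => Kwg.
  have Kg : K (phi g) by have := KM _ _ Kgk Kk; rewrite mulgVK.
  exists (w * g); first by apply: WM => //; exact: KW.
  have := KV _ Kwg; rewrite phiM !invgM !invgK !mulgA.
  by [].
exists (\bigcup_(C in E) C); first split.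
- apply/subgroupP; split.
  + by apply: (inE _ 1) => //; rewrite morph1 invg1 mulg1.
  + move=> x y /Ein[w Ww Kx] /Ein[v Wv Ky].
    have [u Wu Ku] := swap _ _ Ww Ky; apply: (inE _ (u * v)); first exact: WM.
    have := KM _ _ Kx Ku; rewrite phiM invgM !mulgA mulgVK.
    by [].
  + move=> x /Ein[w Ww /KV]; rewrite invgM invgK => Kx.
    have [u Wu Ku] := swap _ _ (WV _ Ww) Kx; apply: (inE _ u) => //.
    by move: Ku; rewrite morphV mulgA mulVg mul1g.
- apply: compact_bigcup_finite.
    have := finite_image (fun C => setmul K (phi @` C)) fW.
    apply: sub_finite_set => _ [w Ww <-].
    exists (rcoset (phi @^-1` K) w); first by exists w.
    apply/seteqP; split=> y.
      move=> [k Kk [_ [v /rcosetE Kvw <-] <-]]; apply/rcosetE.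
      by rewrite -mulgA -morphV -phiM; exact: KM.
    move=> [k Kk <-]; exists k => //; exists (phi w) => //; exists w => //.
    exact/rcoset_refl/preimage_subgroup.
  by move=> _ [w _ <-]; exact: compact_rcoset.
- by apply: bigcup_open => _ [w _ <-]; exact: open_rcoset.
apply/seteqP; split=> g.
  move=> /Ein[w Ww]; rewrite -morphV -phiM => /KW /WM /(_ Ww).
  by rewrite mulgVK.
by move=> Wg; apply: (inE _ g) => //; rewrite mulgV.
Qed.

Lemma compact_open_preimages_stable : tdlc H ->
  stable_local_filter (compact_open_preimages phi).
Proof.
move=> tH; split.
- by move=> _ [K [sK _ _] <-]; exact: preimage_subgroup.
- by move=> _ [K [_ _ oK] <-]; apply: open_comp => // x _; exact: phi_cont.
- have [K cosK _] := compact_open_subgroup_basis tH filterT.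
  by exists (phi @^-1` K), K.
- move=> _ _ [K [sK cK oK] <-] [L [sL cL oL] <-].
  rewrite /commensurate -preimage_setI.
  have sKL := subgroupI sK sL; have oKL := openI oK oL.
  by split; apply: preimage_finite_index; exact: compact_finite_index.
- move=> _ _ [K cosK <-] [L cosL <-]; exists (K `&` L) => //.
  exact: compact_open_subgroupI.
- move=> V W sW VW fW [K cosK KV]; rewrite -KV in VW fW.
  have [L cosL LW] := finite_index_overgroup cosK sW VW fW.
  by exists L.
- move=> _ g [K [sK cK oK] <-]; rewrite -preimage_conjset.
  exists (conjset (phi g) K) => //; split.
  + exact: subgroup_conjset.
  + exact: compact_conjset.
  + exact: open_conjset.
Qed.

(** * The trace on G of a point of H *)

Hypothesis tdlcH : tdlc H.
Let hS := compact_open_preimages_stable tdlcH.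
Let S := LocalFilter hS.

(** The pull-back along phi of the neighbourhood filter of h, generated by the
    basic neighbourhoods K h. *)
Definition trace_filter h : set_system G :=
  filter_from compact_open_subgroup (fun K => phi @^-1` rcoset K h).

(** If the trace contains (phi^-1 K) g, it contains a smaller coset
    phi^-1 (L h); by density some phi x lies in both K h and L h, hence in
    both K h and K phi(g), and these cosets of K coincide. *)
Lemma trace_filterP K g h : compact_open_subgroup K ->
  trace_filter h (rcoset (phi @^-1` K) g) <-> rcoset K (phi g) h.
Proof.
move=> cosK; have [sK _ oK] := cosK; rewrite -preimage_rcoset; split.
  move=> [L cosL LK]; have [sL _ oL] := cosL.
  have [x KLx] := rcoset_meets_range h (subgroupI sK sL) (openI oK oL).
  have Kx : rcoset K h (phi x) by case: KLx => y [Ky _] <-; exists y.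
  have Lx : rcoset L h (phi x) by case: KLx => y [_ Ly] <-; exists y.
  rewrite (rcoset_eq sK (LK _ Lx)) -(rcoset_eq sK Kx); exact: rcoset_refl.
by move=> Kh; exists K => //; rewrite -(rcoset_eq sK Kh).
Qed.

Lemma trace_cauchy h : cauchy_filter S (trace_filter h).
Proof.
have FF : ProperFilter (trace_filter h).
  apply: filter_from_proper => [|K [sK _ oK]]; last first.
    exact: rcoset_meets_range.
  apply: filter_from_filter.
    by have [K cosK _] := compact_open_subgroup_basis tdlcH filterT; exists K.
  move=> K L cosK cosL; exists (K `&` L); first exact: compact_open_subgroupI.
  by move=> x [y [Ky Ly] yx]; split; exists y.
have coset K : compact_open_subgroup K ->
    exists2 g, trace_filter h (rcoset (phi @^-1` K) g) &
      rcoset K (phi g) = rcoset K h.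
  move=> cosK; have [sK _ oK] := cosK.
  have [g Kg] := rcoset_meets_range h sK oK; have Kgh := rcoset_eq sK Kg.
  exists g => //; apply/trace_filterP => //.
  by rewrite -Kgh; exact: rcoset_refl.
apply: mk_cauchy => [_ [K cosK <-]|A [K cosK KA]].
  by have [g ? _] := coset K cosK; exists g.
have [g hg gh] := coset K cosK; exists (phi @^-1` K), g; split=> //.
  by exists K.
by rewrite -preimage_rcoset gh.
Qed.

Definition trace h : completion S := Completion (trace_cauchy h).

Lemma traceP K g h : compact_open_subgroup K ->
  trace h (rcoset (phi @^-1` K) g) <-> rcoset K (phi g) h.
Proof. exact: trace_filterP. Qed.

(** The product of K x and (x^-1 K x) y is contained in K x y. *)
Lemma traceM : {morph trace : x y / x * y}.
Proof.
move=> x y; apply: completion_eq => _ g [K cosK <-] /(traceP _ _ cosK) Kg.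
have [sK cK oK] := cosK.
apply/mul_filterP; exists (phi @^-1` rcoset K x).
exists (phi @^-1` rcoset (conjset x^-1 K) y); split.
- by exists K.
- exists (conjset x^-1 K) => //; split.
  + exact: subgroup_conjset.
  + exact: compact_conjset.
  + exact: open_conjset.
move=> b c /rcosetE Kb /rcosetE/conjsetE; rewrite invgK => Kc.
rewrite -preimage_rcoset /= phiM (rcoset_eq sK Kg); apply/rcosetE.
have /subgroupP[_ KM _] := sK; have := KM _ _ Kb Kc.
by rewrite invgM !mulgA mulgVK.
Qed.

Lemma trace_inj : injective trace.
Proof.
move=> x y xy; apply: contrapT => nxy.
have nA : nbhs (1 : H) (~` [set x * y^-1]).
  apply: open_nbhs_nbhs; split.
    apply: closed_openC; apply: accessible_closed_set1.
    exact/hausdorff_accessible/topgroup_hausdorff.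
  by move=> /esym/divg1_eq.
have [K cosK KA] := compact_open_subgroup_basis tdlcH nA.
have [sK _ oK] := cosK.
have [g Kg] := rcoset_meets_range y sK oK.
have : rcoset K (phi g) y by rewrite -(rcoset_eq sK Kg); exact: rcoset_refl.
move=> /(traceP _ _ cosK); rewrite -xy => /(traceP _ _ cosK).
by rewrite -(rcoset_eq sK Kg) => /rcosetE /KA; apply.
Qed.

(** The image of f under phi contains a coset of a compact K, hence has a
    cluster point h.  If f contains (phi^-1 L) a, then L phi(a) is a member of
    the image of f and meets the neighbourhood L h of h, so that it is L h. *)
Lemma trace_surj f : exists h, trace h = f.
Proof.
have [K cosK _] := compact_open_subgroup_basis tdlcH filterT.
have PF := completion_proper f.
have SK : S (phi @^-1` K) by exists K.
have [g fg] := completion_coset f SK; have [sK cK oK] := cosK.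
have [|h [_ fh]] := @compact_rcoset _ K (phi g) cK (fmap phi f) _.
  by move: fg; rewrite -preimage_rcoset.
exists h; apply/esym/completion_eq => _ a [L cosL <-] fa.
apply/traceP => //; have [sL _ oL] := cosL.
have [||y [Ly Lhy]] := fh (rcoset L (phi a)) (rcoset L h).
- by move: fa; rewrite -preimage_rcoset.
- by apply: open_nbhs_nbhs; split; [exact: open_rcoset|exact: rcoset_refl].
by rewrite (rcoset_eq sL Ly) -(rcoset_eq sL Lhy); exact: rcoset_refl.
Qed.

Lemma trace_continuous : continuous trace.
Proof.
move=> h A /= /completion_nbhsP[_ [g [[K cosK <-] hg KA]]].
have [_ _ oK] := cosK; have : nbhs h (rcoset K (phi g)).
  by apply: open_nbhs_nbhs; split; [exact: open_rcoset|exact/(traceP _ _ cosK)].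
by apply: filterS => x Kx; apply: KA; apply/(traceP _ _ cosK).
Qed.

Lemma trace_inverse_continuous psi : cancel trace psi -> cancel psi trace ->
  continuous psi.
Proof.
move=> traceK psiK f; have [h <-] : exists h, trace h = f by exists (psi f).
move=> A; rewrite /= traceK => hA.
have nA : nbhs (1 : H) [set x | A (x * h)].
  by apply: mulgr_continuous; rewrite mul1g.
have [K cosK KA] := compact_open_subgroup_basis tdlcH nA.
have [sK _ oK] := cosK; have [g Kg] := rcoset_meets_range h sK oK.
apply/completion_nbhsP; exists (phi @^-1` K), g; split.
- by exists K.
- apply/(traceP _ _ cosK); rewrite -(rcoset_eq sK Kg); exact: rcoset_refl.
move=> k; rewrite -[k]psiK => /(traceP _ _ cosK).
by rewrite /= traceK -(rcoset_eq sK Kg) => -[v /KA /= ? <-].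
Qed.

Lemma trace_beta g : trace (phi g) = beta S g.
Proof.
apply: completion_eq => _ a [K cosK <-] /(traceP _ _ cosK).
have [sK _ _] := cosK => Kg; exists (phi @^-1` K); first by exists K.
by rewrite -!preimage_rcoset (rcoset_eq sK Kg).
Qed.

(** * The isomorphism *)

Lemma completion_isom : exists! psi : completion S -> H,
  topgroup_isom psi /\ phi = psi \o beta S.
Proof.
pose psi f := xget 1 [set h | trace h = f].
have psiK : cancel psi trace by move=> f; exact: xgetPex (trace_surj f).
have traceK : cancel trace psi by move=> h; apply: trace_inj; exact: psiK.
have psic := trace_inverse_continuous traceK psiK.
have phiE : phi = psi \o beta S.
  by apply/funext => g /=; rewrite -trace_beta traceK.
exists psi; split.
  split=> //; split=> //.
    by move=> f k; apply: trace_inj; rewrite traceM !psiK.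
  by exists trace => //; exact: trace_continuous.
move=> psi' [[_ psi'c _] phiE']; apply/funext => f.
apply: (@topgroup_hausdorff H) => A B /psic fA /psi'c fB.
have : nbhs f (psi @^-1` A `&` psi' @^-1` B).
  by apply: filterI; [exact: fA|exact: fB].
rewrite nbhsE => -[U [oU Uf] UAB].
have [|k [Uk [g _ gk]]] := @beta_dense _ S U _ oU; first by exists f.
have [Ak Bk] := UAB _ Uk; exists (phi g).
by split; [rewrite phiE /= gk|rewrite phiE' /= gk].
Qed.

End preimages.

Theorem theorem4p3 (G H : topGroupType) (phi : G -> H)
    (hphi : tdlc_completion phi) :
  exists hS : stable_local_filter (compact_open_preimages phi),
    exists! psi : completion (LocalFilter hS) -> H,
      topgroup_isom psi /\ phi = psi \o beta (LocalFilter hS).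
Proof.
case: hphi => tH phiM phic phid.
exists (compact_open_preimages_stable phiM phic phid tH).
exact: completion_isom.
Qed.
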